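(* Let $r(t)$, $t=0,1,2,\dots$, be a sequence of independent, identically distributed random variables in $\{1,\dots,\ell\}$ with probabilities $\rho_r>0$ for every $r$. Assume that the hypergraph $\mathcal H$ with node set $C$ and edges $C_1,\dots,C_\ell$ is connected. Consider the iterative algorithm which, starting from any $q_C(0)$ with $\mathbf{1}^Tq_C(0)+\mathbf{1}^Tq_{V\setminus C}=0$, at each step $t$ sets $q_C(t+1)$ to be the minimizer $q'_C$ of $J\left(\begin{bmatrix} q'_C \\ q_{V\setminus C} \end{bmatrix}\right)$ subject to $q'_C-q_C(t)\in\mathcal S_{r(t)}$, equivalently $$q_C(t+1)=q_C(t)-(\Omega_{r(t)}M\Omega_{r(t)})^\sharp\,(Mq_C(t)+Nq_{V\setminus C}).$$ Then $q_C(t)$ converges in mean square to the global optimal solution $q_C^{\mathrm{opt}}$, i.e. $\mathbb{E}\|q_C(t)-q_C^{\mathrm{opt}}\|^2\to0$ as $t\to\infty$, where $q_C^{\mathrm{opt}}$ is the solution of the problem of minimizing $J(q)$ over $q_C\in\mathbb{R}^m$ (with $q_{V\setminus C}$ fixed) subject to $\mathbf{1}^Tq=0$.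
   Context: Let $G$ be a finite directed graph with node set $V$, $|V|=n$, a distinguished node $0$, and edge set $E$ (each edge $e$ going from $\sigma(e)$ to $\tau(e)$), connected irrespective of edge orientation. $A\in\{0,\pm1\}^{|E|\times n}$ is the incidence matrix: $[A]_{ev}=-1$ if $v=\sigma(e)$, $1$ if $v=\tau(e)$, $0$ otherwise. Each edge has an impedance $z_e\in\mathbb{C}$ with $\mathrm{Re}(z_e)>0$; $Z=\mathrm{diag}(z_e)$, $L=A^TZ^{-1}A$, and $X\in\mathbb{C}^{n\times n}$ is the unique symmetric matrix with $XL=I-\mathbf{1}\mathbf{1}_0^T$, $X\mathbf{1}_0=0$ (with $\mathbf{1}$ the all-ones vector, $\mathbf{1}_0$ the basis vector of node $0$). $C\subseteq V$ is the set of compensators, $m=|C|\ge2$. Ordering the nodes of $C$ first, $q=\begin{bmatrix} q_C \\ q_{V\setminus C} \end{bmatrix}\in\mathbb{R}^n$ with $q_{V\setminus C}$ fixed, $\mathrm{Re}(X)=\begin{bmatrix} M & N \\ N^T & Q \end{bmatrix}$ with $M\in\mathbb{R}^{m\times m}$, and $J(q)=\frac12q^T\mathrm{Re}(X)q$. The clusters $C_1,\dots,C_\ell$ are nonempty, possibly overlapping subsets of $C$ with $\bigcup_rC_r=C$. Vectors in $\mathbb{R}^m$ are indexed by $C$; $\mathbf{1}_{C_r}$ is the indicator vector of $C_r$, $$\Omega_r:=\mathrm{diag}(\mathbf{1}_{C_r})-\frac{1}{|C_r|}\mathbf{1}_{C_r}\mathbf{1}_{C_r}^T,\qquad \mathcal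 S_r:=\Big\{y\in\mathbb{R}^m:\ \sum_{k\in C_r}y_k=0,\ y_k=0\ \forall k\notin C_r\Big\},$$ and $\sharp$ denotes the Moore–Penrose pseudoinverse. A hypergraph is connected if any two nodes are joined by a chain of hyperedges in which consecutive hyperedges intersect. *)

(* Defs.v *)
From mathcomp Require Import all_boot all_order all_algebra.
From mathcomp Require Import all_classical all_reals all_analysis.
From mathcomp Require Import complex.

Set Implicit Arguments.
Unset Strict Implicit.
Unset Printing Implicit Defensive.

Import Order.TTheory GRing.Theory Num.Theory.

Local Open Scope classical_set_scope.
Local Open Scope complex_scope.
Local Open Scope ring_scope.

Definition edge_rel (n p : nat) (src tgt : 'I_p -> 'I_n) : rel 'I_n :=
  fun u v => [exists e, ((src e == u) && (tgt e == v))
                     || ((src e == v) && (tgt e == u))].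

Definition graph_connected (n p : nat) (src tgt : 'I_p -> 'I_n) : Prop :=
  forall u v, connect (edge_rel src tgt) u v.

(* The difference gives -1 at the source, 1 at the target and 0 elsewhere;
   should an edge be a self-loop, its row is 0. *)
Definition incidence_mx (F : fieldType) (n p : nat) (src tgt : 'I_p -> 'I_n) :
    'M[F]_(p, n) :=
  \matrix_(e, v) ((v == tgt e)%:R - (v == src e)%:R).

Definition laplacian_mx (R : realType) (n p : nat) (src tgt : 'I_p -> 'I_n)
    (z : 'I_p -> R[i]) : 'M[R[i]]_n :=
  (incidence_mx _ src tgt)^T *m invmx (diag_mx (\row_e z e))
    *m incidence_mx _ src tgt.

Definition is_green_mx (R : realType) (n : nat) (v0 : 'I_n)
    (L X : 'M[R[i]]_n) : Prop :=
  let one0 : 'cV[R[i]]_n := delta_mx v0 0 in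
  [/\ X^T = X, X *m L = 1%:M - const_mx 1 *m one0^T & X *m one0 = 0].

(* The bijection listing the nodes of C first and those of ~: C next.
   Coordinate i : 'I_#|C| of a vector indexed by C is that of node enum_val i. *)
Definition nodes_C_first (n : nat) (C : {set 'I_n})
    (i : 'I_(#|C| + #|~: C|)) : 'I_n :=
  match fintype.split i with
  | inl a => enum_val a
  | inr b => enum_val b
  end.

Section BlocksAndCost.
Context (R : realType) (n : nat) (C : {set 'I_n}) (X : 'M[R[i]]_n).

Definition ReX : 'M[R]_(#|C| + #|~: C|) :=
  mxsub (@nodes_C_first n C) (@nodes_C_first n C) (map_mx (@complex.Re R) X).

Definition blockM : 'M[R]_#|C| := ulsubmx ReX.

Definition blockN : 'M[R]_(#|C|, #|~: C|) := ursubmx ReX.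

Definition J (q : 'cV[R]_(#|C| + #|~: C|)) : R :=
  2^-1 * (q^T *m ReX *m q) 0 0.

End BlocksAndCost.

Section Clusters.
Context (R : realType) (n : nat) (C D : {set 'I_n}).

Definition indicator : 'cV[R]_#|C| := \col_i (enum_val i \in D)%:R.

Definition Omega : 'M[R]_#|C| :=
  diag_mx indicator^T - (#|D|%:R)^-1 *: (indicator *m indicator^T).

Definition cluster_space : set 'cV[R]_#|C| :=
  [set y | \sum_(k | enum_val k \in D) y k 0 = 0 /\
           forall k, enum_val k \notin D -> y k 0 = 0].

End Clusters.

Definition entry_sum (R : realType) (m : nat) (x : 'cV[R]_m) : R := \sum_i x i 0.

(* The norm `|x| provided for matrices is the max norm, hence this one. *)
Definition sqnorm (R : realType) (m : nat) (x : 'cV[R]_m) : R :=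
  \sum_i x i 0 ^+ 2.

Definition is_minimizer (R : realType) (T : Type) (S : set T) (f : T -> R)
    (x : T) : Prop :=
  S x /\ forall y, S y -> f x <= f y.

Definition is_cluster_step (R : realType) (n : nat) (C : {set 'I_n})
    (X : 'M[R[i]]_n) (qD : 'cV[R]_#|~: C|) (D : {set 'I_n})
    (x : 'cV[R]_#|C|) : 'cV[R]_#|C| -> Prop :=
  is_minimizer [set x' | cluster_space D (x' - x)]
    (fun x' => J X (col_mx x' qD)).

Definition is_global_opt (R : realType) (n : nat) (C : {set 'I_n})
    (X : 'M[R[i]]_n) (qD : 'cV[R]_#|~: C|) : 'cV[R]_#|C| -> Prop :=
  is_minimizer [set x | entry_sum (col_mx x qD) = 0]
    (fun x => J X (col_mx x qD)).

Definition is_pinv (R : realType) (m k : nat) (A : 'M[R]_(m, k))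
    (G : 'M[R]_(k, m)) : Prop :=
  [/\ A *m G *m A = A, G *m A *m G = G,
      (A *m G)^T = A *m G & (G *m A)^T = G *m A].

Definition pinvmp (R : realType) (m k : nat) (A : 'M[R]_(m, k)) :
    'M[R]_(k, m) :=
  xget 0 [set G | is_pinv A G].

Lemma is_pinv_uniq (R : realType) (m k : nat) (A : 'M[R]_(m, k))
    (G H : 'M[R]_(k, m)) : is_pinv A G -> is_pinv A H -> G = H.
Proof.
move=> [AGA GAG AGT GAT] [AHA HAH AHT HAT].
have AGH : A *m G = A *m H.
  have /(congr1 trmx) : (A *m G) *m (A *m H) = A *m H by rewrite mulmxA AGA.
  by rewrite trmx_mul AGT AHT mulmxA AHA.
have GHA : G *m A = H *m A.
  have /(congr1 trmx) : (H *m A) *m (G *m A) = H *m A.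
    by rewrite -mulmxA (mulmxA A) AGA.
  by rewrite trmx_mul GAT HAT -mulmxA (mulmxA A) AHA.
by rewrite -GAG GHA -mulmxA AGH mulmxA HAH.
Qed.

Lemma gram_unit (R : realType) (m k : nat) (B : 'M[R]_(m, k)) :
  row_free B -> B *m B^T \in unitmx.
Proof.
move=> Bfree; rewrite -row_free_unit -kermx_eq0; apply/eqP/row_matrixP => i.
rewrite row0; set v := row i _.
have vBB : v *m (B *m B^T) = 0 by apply/sub_kermxP; exact: row_sub.
have : ((v *m B) *m (v *m B)^T) 0 0 = 0.
  by rewrite trmx_mul mulmxA -(mulmxA v) vBB mul0mx mxE.
rewrite mxE => /eqP; rewrite psumr_eq0 => [/allP w0|j _]; last first.
  by rewrite [X in _ * X]mxE -expr2 sqr_ge0.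
suff vB0 : v *m B = 0 by apply: (row_free_inj Bfree); rewrite vB0 mul0mx.
apply/rowP => j; rewrite [RHS]mxE.
by have := w0 j (mem_index_enum j); rewrite /= [X in _ * X]mxE mulf_eq0 orbb => /eqP.
Qed.

Lemma pinvmpP (R : realType) (m k : nat) (A : 'M[R]_(m, k)) :
  is_pinv A (pinvmp A).
Proof.
suff [G AG] : exists G, is_pinv A G by exact: (xgetPex 0 (ex_intro _ G AG)).
have [e [B [D [defA UB UD]]]] : exists e (B : 'M[R]_(m, e)) (D : 'M[R]_(e, k)),
    [/\ B *m D = A, B^T *m B \in unitmx & D *m D^T \in unitmx].
  exists (\rank A), (col_base A), (row_base A); split.
  - exact: mulmx_base.
  - rewrite -[X in _ *m X]trmxK; apply: gram_unit.
    by rewrite /row_free mxrank_tr; exact: col_base_full.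
  - exact/gram_unit/row_base_free.
pose BI := invmx (B^T *m B) *m B^T; pose DI := D^T *m invmx (D *m D^T).
have BIB : BI *m B = 1%:M by rewrite -mulmxA mulVmx.
have DDI : D *m DI = 1%:M by rewrite mulmxA mulmxV.
have AG : B *m D *m (DI *m BI) = B *m BI.
  by rewrite -mulmxA (mulmxA D) DDI mul1mx.
have GA : (DI *m BI) *m (B *m D) = DI *m D.
  by rewrite -mulmxA (mulmxA BI) BIB mul1mx.
exists (DI *m BI); rewrite -defA; split; rewrite ?AG ?GA.
- by rewrite -mulmxA (mulmxA BI) BIB mul1mx.
- by rewrite -mulmxA (mulmxA D) DDI mul1mx.
- by rewrite /BI !trmx_mul trmx_inv trmx_mul trmxK mulmxA.
- by rewrite /DI !trmx_mul trmx_inv trmx_mul trmxK mulmxA.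
Qed.

Definition cluster_update (R : realType) (n : nat) (C : {set 'I_n})
    (X : 'M[R[i]]_n) (qD : 'cV[R]_#|~: C|) (D : {set 'I_n})
    (x : 'cV[R]_#|C|) : 'cV[R]_#|C| :=
  x - pinvmp (Omega R C D *m blockM C X *m Omega R C D)
        *m (blockM C X *m x + blockN C X *m qD).

Definition hypergraph_connected (n l : nat) (C : {set 'I_n})
    (Cl : 'I_l -> {set 'I_n}) : Prop :=
  forall u v, u \in C -> v \in C ->
    exists (r : 'I_l) (s : seq 'I_l),
      [/\ u \in Cl r, v \in Cl (last r s) &
          path (fun a b => Cl a :&: Cl b != finset.set0) r s].

Definition mutually_independent (d : measure_display) (T : measurableType d)
    (R : realType) (P : probability T R) (K : Type) (r : nat -> T -> K) : Prop :=
  forall (s : seq nat) (B : nat -> set K), uniq s ->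
    P (\bigcap_(t in [set` s]) (r t @^-1` B t)) =
    (\prod_(t <- s) P (r t @^-1` B t))%E.

Definition iid_with_law (d : measure_display) (T : measurableType d)
    (R : realType) (P : probability T R) (l : nat) (r : nat -> T -> 'I_l)
    (rho : 'I_l -> R) : Prop :=
  [/\ forall t k, measurable (r t @^-1` [set k]),
      forall t k, P (r t @^-1` [set k]) = (rho k)%:E
    & mutually_independent P r].

(* Main.v *)
Require Import Defs.
From mathcomp Require Import all_boot all_order all_algebra.
From mathcomp Require Import all_classical all_reals all_analysis.
From mathcomp Require Import measurable_realfun complex ring.

Import Order.TTheory GRing.Theory Num.Theory.
Import numFieldNormedType.Exports.

Local Open Scope classical_set_scope.
Local Open Scope complex_scope.
Local Open Scope ring_scope.

Set Implicit Arguments.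
Unset Strict Implicit.
Unset Printing Implicit Defensive.

(** Write M for the compensator block of Re X.  For a zero-sum y the edge flow
    f = Z^-1 A X y satisfies A^T f = y and y^T Re(X) y = sum_e Re(z_e) |f_e|^2,
    so M is positive definite on zero-sum vectors.  The error x = q_C - q_C^opt
    is then moved by a cluster step to x - G_k M x, which lowers x^T M x by the
    energy of G_k M x.  The rho-average of these drops is a quadratic form that
    vanishes on a zero-sum x only if M x is constant on every cluster, hence on
    C by connectedness, hence x = 0; by compactness it dominates a multiple of
    x^T M x.  By independence the expected energy thus decays geometrically. *)

(** * Quadratic forms *)

Definition qform (R : realType) (m : nat) (A : 'M[R]_m) (x : 'cV[R]_m) : R :=
  (x^T *m A *m x) 0 0.

Lemma qformE (R : realType) (m : nat) (A : 'M[R]_m) (x : 'cV[R]_m) :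
  qform A x = \sum_i \sum_j x i 0 * A i j * x j 0.
Proof.
rewrite /qform mxE exchange_big /=; apply: eq_bigr => j _.
by rewrite mxE mulr_suml; apply: eq_bigr => i _; rewrite mxE.
Qed.

Lemma qform0 (R : realType) (m : nat) (A : 'M[R]_m) : qform A 0 = 0.
Proof. by rewrite /qform mulmx0 mxE. Qed.

Lemma qformD (R : realType) (m : nat) (A : 'M[R]_m) (x y : 'cV[R]_m) :
  A^T = A -> qform A (x + y) = qform A x + 2 * (y^T *m (A *m x)) 0 0 + qform A y.
Proof.
move=> Asym.
have xAy : (x^T *m A *m y) 0 0 = (y^T *m (A *m x)) 0 0.
  rewrite [LHS](_ : _ = (x^T *m A *m y)^T 0 0); last by rewrite [RHS]mxE.
  by rewrite !trmx_mul trmxK Asym.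
rewrite /qform [(x + y)^T]linearD /= !mulmxDl !mulmxDr -(mulmxA y^T A x).
rewrite [LHS]mxE [X in X + _]mxE [X in _ + X]mxE xAy; ring.
Qed.

Lemma qformN (R : realType) (m : nat) (A : 'M[R]_m) (x : 'cV[R]_m) :
  qform A (- x) = qform A x.
Proof. by rewrite /qform [(- x)^T]linearN /= !mulNmx mulmxN opprK. Qed.

(** * Positivity of Re X on zero-sum vectors *)

(** Transposing [X L = I - 1 1_0^T] gives [L X = I - 1_0 1^T], which fixes a zero-sum [y]; hence the
    flow Z^-1 A X y has divergence [y]. *)
Lemma green_edge_flow (R : realType) (n p : nat) (src tgt : 'I_p -> 'I_n)
    (v0 : 'I_n) (z : 'I_p -> R[i]) (X : 'M[R[i]]_n) (y : 'cV[R[i]]_n) :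
  (forall e, 0 < complex.Re (z e)) ->
  is_green_mx v0 (laplacian_mx src tgt z) X ->
  const_mx 1 *m y = 0 :> 'cV_1 ->
  exists f : 'cV[R[i]]_p, (incidence_mx _ src tgt)^T *m f = y /\
    incidence_mx _ src tgt *m (X *m y) = diag_mx (\row_e z e) *m f.
Proof.
move=> hz [Xsym XL _] y0.
set A := incidence_mx _ src tgt; set Z := diag_mx _.
have Zunit : Z \in unitmx.
  rewrite unitmxE det_diag unitfE; apply/prodf_neq0 => e _; rewrite mxE.
  by apply: contraTneq (hz e) => ->; rewrite ltxx.
exists (invmx Z *m (A *m (X *m y))); split; last by rewrite mulKVmx.
have LX : (A^T *m invmx Z *m A) *m X = 1%:M - delta_mx v0 0 *m (const_mx 1 : 'cV_n)^T.
  have := congr1 trmx XL; rewrite linearB /= !trmx_mul trmx1 !trmxK Xsym => <-.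
  by rewrite trmx_inv tr_diag_mx !mulmxA.
rewrite !mulmxA LX mulmxBl mul1mx -mulmxA trmx_const y0 mulmx0.
by rewrite subr0.
Qed.

(** As [A] and [y] are real, [y^T = conj(f)^T A], so the form is the real part of [conj(f)^T Z f], a
    sum of nonnegative edge losses. If it vanishes then [f = 0], whence [y = A^T f = 0]. *)
Lemma green_qform_gt0 (R : realType) (n p : nat) (src tgt : 'I_p -> 'I_n)
    (v0 : 'I_n) (z : 'I_p -> R[i]) (X : 'M[R[i]]_n) (y : 'cV[R]_n) :
  (forall e, 0 < complex.Re (z e)) ->
  is_green_mx v0 (laplacian_mx src tgt z) X ->
  entry_sum y = 0 -> y != 0 -> 0 < qform (map_mx (@complex.Re R) X) y.
Proof.
move=> hz hX y0 yN0; pose yc := map_mx (real_complex R) y.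
have [|f [Af Auf]] := green_edge_flow (y := yc) hz hX.
  apply/colP => i; rewrite !mxE (eq_bigr (fun v => real_complex R (y v 0))).
    by rewrite -rmorph_sum /= -/(entry_sum y) y0.
  by move=> v _; rewrite !mxE mul1r.
set A := incidence_mx _ _ _ in Af Auf.
have -> : qform (map_mx (@complex.Re R) X) y =
    \sum_e complex.Re (z e) * (complex.Re (f e 0) ^+ 2 + complex.Im (f e 0) ^+ 2).
  have -> : qform (map_mx (@complex.Re R) X) y =
      complex.Re ((yc^T *m (X *m yc)) 0 0).
    rewrite mulmxA mxE raddf_sum /= qformE exchange_big /=; apply: eq_bigr => j _.
    rewrite mxE mulr_suml raddf_sum /=; apply: eq_bigr => i _; rewrite !mxE /=.
    by case: (X i j) => a b /=; simpc.
  have conjA : map_mx conjc A = A.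
    by apply/matrixP => i j; rewrite !mxE rmorphB /= !rmorph_nat.
  have -> : yc^T = (map_mx conjc f)^T *m A.
    rewrite -[A in RHS]trmxK -trmx_mul.
    rewrite (_ : A^T = map_mx conjc A^T) -?map_mxM ?Af; last first.
      by rewrite -map_trmx conjA.
    by congr trmx; apply/matrixP => i j; rewrite !mxE /= oppr0.
  rewrite -mulmxA Auf mxE raddf_sum.
  apply: eq_bigr => e _; rewrite mul_diag_mx !mxE.
  case: (f e 0) (z e) => a b [c d] /=; simpc => /=; ring.
have term_ge0 e : 0 <= complex.Re (z e) *
    (complex.Re (f e 0) ^+ 2 + complex.Im (f e 0) ^+ 2).
  by rewrite mulr_ge0 ?addr_ge0 ?sqr_ge0 // ltW.
rewrite lt_def sumr_ge0 // andbT; apply: contraNneq yN0 => /eqP.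
rewrite psumr_eq0 // => /allP f0.
have {}f0 : f = 0.
  apply/colP => e; rewrite mxE; have := f0 e (mem_index_enum e).
  rewrite /= mulf_eq0 gt_eqF //= paddr_eq0 ?sqr_ge0 // !sqrf_eq0.
  by case: (f e 0) => a b /= /andP[/eqP -> /eqP ->].
apply/eqP/colP => v; have := congr1 (fun M : 'cV_n => M v 0) Af.
by rewrite f0 mulmx0 !mxE => -[].
Qed.

Lemma nodes_C_first_bij (n : nat) (C : {set 'I_n}) :
  bijective (@nodes_C_first n C).
Proof.
apply: inj_card_bij; last by rewrite !card_ord cardsC card_ord.
move=> i j; rewrite /nodes_C_first.
case: (splitP i) => a ia; case: (splitP j) => b jb.
- by move=> /enum_val_inj ab; apply: val_inj; rewrite /= ia jb ab.
- by move=> ab; have := enum_valP b; rewrite -ab inE enum_valP.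
- by move=> ab; have := enum_valP a; rewrite ab inE enum_valP.
- by move=> /enum_val_inj ab; apply: val_inj; rewrite /= ia jb ab.
Qed.

Lemma ReX_sym (R : realType) (n : nat) (C : {set 'I_n}) (X : 'M[R[i]]_n) :
  X^T = X -> (ReX C X)^T = ReX C X.
Proof.
move=> Xsym; apply/matrixP => i j; rewrite !mxE.
by rewrite -[in LHS]Xsym mxE.
Qed.

(** Extending [x] by zero off [C] and undoing the reordering of the nodes keeps the sum and turns
    the form of [M] into that of Re X. *)
Lemma blockM_gt0 (R : realType) (n p : nat) (src tgt : 'I_p -> 'I_n)
    (v0 : 'I_n) (z : 'I_p -> R[i]) (X : 'M[R[i]]_n) (C : {set 'I_n})
    (x : 'cV[R]_#|C|) :
  (forall e, 0 < complex.Re (z e)) ->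
  is_green_mx v0 (laplacian_mx src tgt z) X ->
  entry_sum x = 0 -> x != 0 -> 0 < qform (blockM C X) x.
Proof.
move=> hz hX x0 xN0; have [g nodesK gK] := nodes_C_first_bij C.
have nodes_bij := onW_bij xpredT (nodes_C_first_bij C).
pose w : 'cV[R]__ := col_mx x (0 : 'cV_#|~: C|).
pose y : 'cV[R]_n := \col_v w (g v) 0.
have yE i : y (nodes_C_first i) 0 = w i 0 by rewrite mxE nodesK.
have -> : qform (blockM C X) x = qform (map_mx (@complex.Re R) X) y.
  transitivity (qform (ReX C X) w).
    rewrite /qform /w -[in RHS](submxK (ReX C X)) tr_col_mx mul_row_block.
    by rewrite trmx0 !mul0mx !addr0 mul_row_col mulmx0 addr0.
  rewrite !qformE [RHS](reindex _ nodes_bij) /=; apply: eq_bigr => i _.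
  rewrite [RHS](reindex _ nodes_bij) /=; apply: eq_bigr => j _.
  by rewrite !yE [ReX _ _ _ _]mxE.
apply: (green_qform_gt0 hz hX).
  rewrite /entry_sum (reindex _ nodes_bij) /=.
  under eq_bigr do rewrite yE.
  rewrite big_split_ord /= [X in _ + X]big1 ?addr0.
    by rewrite -[RHS]x0; apply: eq_bigr => i _; rewrite col_mxEu.
  by move=> i _; rewrite col_mxEd mxE.
apply: contraNneq xN0 => /colP y0; apply/eqP/colP => i.
have := y0 (nodes_C_first (lshift _ i)).
by rewrite yE col_mxEu !mxE.
Qed.

(** * Pseudoinverse of the compression of a form to the range of an orthogonal projection *)

Section CompressedPinv.
Context (R : realType) (m : nat) (H Om : 'M[R]_m).
Hypotheses (Hsym : H^T = H) (Osym : Om^T = Om) (Oidem : Om *m Om = Om).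
Hypothesis Hpos :
  forall x : 'cV[R]_m, Om *m x = x -> x != 0 -> 0 < qform H x.

Let K := Om *m H *m Om.
Let G := pinvmp K.

Let Ksym : K^T = K.
Proof. by rewrite !trmx_mul Osym Hsym mulmxA. Qed.

Let OmK : Om *m K = K.
Proof. by rewrite /K !mulmxA Oidem. Qed.

Let KOm : K *m Om = K.
Proof. by rewrite /K -!mulmxA Oidem. Qed.

(** On the range of [Om] the forms of [K] and [H] agree, so a column killed by [K] has zero
    energy. *)
Lemma compression_inj k (x : 'M[R]_(m, k)) : Om *m x = x -> K *m x = 0 -> x = 0.
Proof.
move=> Ox Kx; apply/matrixP => i j; rewrite mxE.
suff /matrixP/(_ i 0) : col j x = 0 by rewrite !mxE.
apply/eqP/negPn/negP => cN0.
have Oc : Om *m col j x = col j x by rewrite !colE mulmxA Ox.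
have := Hpos Oc cN0; rewrite /qform.
rewrite (_ : _ *m _ = (col j x)^T *m (K *m col j x)).
  by rewrite colE (mulmxA K) Kx mul0mx mulmx0 mxE ltxx.
by rewrite -{1}Oc -{2}Oc trmx_mul Osym /K !mulmxA.
Qed.

(** [G = (G K)^T G = K G^T G], so the range of [G] lies in that of [K], hence in that of [Om]. *)
Lemma mul_pinv_compression : Om *m G = G.
Proof.
have [_ GKG _ GKT] := pinvmpP K; rewrite -/G in GKG GKT.
have GE : K *m G^T *m G = G by rewrite -{1}Ksym -trmx_mul GKT GKG.
by rewrite -GE 2!mulmxA OmK.
Qed.

Lemma pinv_compression_mul : G *m Om = G.
Proof.
have [_ GKG KGT _] := pinvmpP K; rewrite -/G in GKG KGT.
have GE : G *m (G^T *m K) = G by rewrite -{1}Ksym -trmx_mul KGT mulmxA GKG.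
by rewrite -GE -2!mulmxA KOm.
Qed.

(** [K G] is the orthogonal projection onto the range of [K], which is all of the range of [Om]
    because [K] is injective there. *)
Lemma mul_compression_pinv : Om *m H *m G = Om.
Proof.
rewrite -{1}mul_pinv_compression mulmxA -/K.
have [KGK _ KGT _] := pinvmpP K; rewrite -/G in KGK KGT.
apply/eqP; rewrite -subr_eq0; apply/eqP/compression_inj.
  by rewrite mulmxBr mulmxA OmK Oidem.
(* Transposition turns [K (K G - Om)] into [(K G - Om) K], where [K G K = K] applies. *)
rewrite -[LHS]trmxK trmx_mul Ksym linearB /= KGT Osym mulmxBl KGK OmK subrr.
by rewrite trmx0.
Qed.

(** Pythagoras: [h] is [H]-orthogonal to [e - h], because [h = Om h] and [Om H h = Om H e]. *)
Lemma compression_step_energy (e : 'cV[R]_m) :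
  qform H (e - G *m (H *m e)) = qform H e - qform H (G *m (H *m e)).
Proof.
set h := G *m (H *m e).
have hHh : (h^T *m (H *m e)) 0 0 = qform H h.
  have Oh : Om *m h = h by rewrite /h mulmxA mul_pinv_compression.
  have hT : h^T = h^T *m Om by rewrite -{1}Oh trmx_mul Osym.
  rewrite /qform hT -!mulmxA; congr ((_ *m _) _ _).
  by rewrite /h (mulmxA H G) (mulmxA Om (H *m G)) (mulmxA Om H G) mul_compression_pinv.
rewrite qformD // qformN [(- h)^T]linearN /= mulNmx.
rewrite [X in _ + 2 * X]mxE hHh; ring.
Qed.

End CompressedPinv.

(** * Quadratic expansion of the cost and its minimizers *)

Lemma J_colD (R : realType) (n : nat) (C : {set 'I_n}) (X : 'M[R[i]]_n)
    (qD : 'cV[R]_#|~: C|) (x s : 'cV[R]_#|C|) : X^T = X ->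
  J X (col_mx (x + s) qD) = J X (col_mx x qD)
    + (s^T *m (blockM C X *m x + blockN C X *m qD)) 0 0
    + 2^-1 * qform (blockM C X) s.
Proof.
move=> Xsym; rewrite /J -!/(qform _ _).
have -> : col_mx (x + s) qD = col_mx x qD + col_mx s 0.
  by rewrite add_col_mx addr0.
rewrite qformD ?ReX_sym // !mulrDr mulrA mulVf ?pnatr_eq0 // mul1r.
rewrite /qform -{2 3}(submxK (ReX C X)) mul_block_col !tr_col_mx mul_row_col.
by rewrite mul_row_block trmx0 !mul0mx !addr0 mul_row_col mulmx0 addr0.
Qed.

(** The cost is quadratic, so its second-order expansion at [x0] is exact; on [F] only the quadratic
    term remains, and it is positive away from [x0]. *)
Lemma stationary_minimizer (R : realType) (n : nat) (C : {set 'I_n})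
    (X : 'M[R[i]]_n) (qD : 'cV[R]_#|~: C|) (F : set 'cV[R]_#|C|) x0 :
  X^T = X -> F x0 ->
  (forall x, F x ->
    ((x - x0)^T *m (blockM C X *m x0 + blockN C X *m qD)) 0 0 = 0) ->
  (forall x, F x -> x != x0 -> 0 < qform (blockM C X) (x - x0)) ->
  forall x, is_minimizer F (fun x => J X (col_mx x qD)) x <-> x = x0.
Proof.
move=> Xsym Fx0 stat pos.
have JE x : F x -> J X (col_mx x qD) =
    J X (col_mx x0 qD) + 2^-1 * qform (blockM C X) (x - x0).
  by move=> Fx; rewrite -{1}(subrK x0 x) addrC J_colD // stat // addr0.
move=> x; split=> [[Fx xmin]|->].
  apply/eqP/negPn/negP => xx0; have := xmin _ Fx0.
  by rewrite JE // gerDl pmulr_rle0 ?invr_gt0 // leNgt pos.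
split=> // y Fy; rewrite [leRHS]JE // lerDl mulr_ge0 ?invr_ge0 //.
by have [->|yx0] := eqVneq y x0; rewrite ?subrr ?qform0 // ltW // pos.
Qed.

Lemma blockM_sym (R : realType) (n : nat) (C : {set 'I_n}) (X : 'M[R[i]]_n) :
  X^T = X -> (blockM C X)^T = blockM C X.
Proof. by move=> Xsym; rewrite /blockM trmx_ulsub ReX_sym. Qed.

(** * [Omega] as the orthogonal projection onto the cluster space *)

Section OmegaTheory.
Context (R : realType) (n : nat) (C D : {set 'I_n}).
Hypotheses (DC : D \subset C) (D0 : D != finset.set0).

Lemma card_cluster : \sum_(k < #|C| | enum_val k \in D) 1 = #|D|%:R :> R.
Proof.
rewrite -(@big_enum_val_cond _ _ _ _ (mem C) (mem D) (fun=> 1)) /= sumr_const; congr _%:R.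
apply: eq_card => v; rewrite [LHS]unfold_in /=.
by apply: andb_idl; exact: (fintype.subsetP DC v).
Qed.

Lemma cluster_card_neq0 : #|D|%:R != 0 :> R.
Proof. by rewrite pnatr_eq0 cards_eq0. Qed.

Lemma Omega_mulE (y : 'cV[R]_#|C|) i : (Omega R C D *m y) i 0 =
  (enum_val i \in D)%:R * (y i 0 - #|D|%:R^-1 * \sum_(k | enum_val k \in D) y k 0).
Proof.
rewrite mulmxBl mul_diag_mx -scalemxAl -mulmxA !mxE mulrBr; congr (_ - _).
rewrite big_ord1 mulrCA !mxE; congr (_ * (_ * _)).
rewrite [RHS]big_mkcond /=; apply: eq_bigr => k _; rewrite !mxE.
by case: ifP; rewrite ?mul1r ?mul0r.
Qed.

Lemma Omega_sym : (Omega R C D)^T = Omega R C D.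
Proof. by rewrite linearB linearZ /= tr_diag_mx trmx_mul trmxK. Qed.

Lemma Omega_cluster_space (y : 'cV[R]_#|C|) : cluster_space D (Omega R C D *m y).
Proof.
split=> [|k kD]; last by rewrite Omega_mulE (negPf kD) mul0r.
under eq_bigr => k kD do rewrite Omega_mulE kD mul1r.
rewrite sumrB; under [X in _ - X]eq_bigr do rewrite -[X in X * _]mul1r -mulrA.
rewrite -mulr_suml card_cluster mulrA mulfV ?cluster_card_neq0 // mul1r.
by rewrite subrr.
Qed.

Lemma Omega_id (y : 'cV[R]_#|C|) : cluster_space D y -> Omega R C D *m y = y.
Proof.
case=> ysum yD; apply/colP => i; rewrite Omega_mulE ysum mulr0 subr0.
by case: (boolP (_ \in D)) => [|/yD ->]; rewrite ?mul1r ?mulr0.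
Qed.

Lemma Omega_idem : Omega R C D *m Omega R C D = Omega R C D.
Proof.
apply/trmx_inj/row_matrixP => i; apply/trmx_inj; rewrite -!tr_col !trmxK.
by rewrite colE -mulmxA Omega_id ?colE //; exact: Omega_cluster_space.
Qed.

Lemma cluster_space_sum0 (y : 'cV[R]_#|C|) : cluster_space D y -> entry_sum y = 0.
Proof.
case=> ysum yD; rewrite /entry_sum (bigID (fun k => enum_val k \in D)) /= ysum.
by rewrite add0r big1.
Qed.

Lemma Omega_pos (H : 'M[R]_#|C|) :
  (forall x, entry_sum x = 0 -> x != 0 -> 0 < qform H x) ->
  forall x, Omega R C D *m x = x -> x != 0 -> 0 < qform H x.
Proof.
move=> Hpos x <-; apply: Hpos; apply: cluster_space_sum0.
exact: Omega_cluster_space.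
Qed.

End OmegaTheory.

(** * Cluster steps and the global optimum *)

Lemma cluster_space_full (R : realType) (n : nat) (C : {set 'I_n})
    (y : 'cV[R]_#|C|) : cluster_space C y <-> entry_sum y = 0.
Proof.
split=> [|y0]; first exact: cluster_space_sum0.
split=> [|k]; last by rewrite enum_valP.
by rewrite -[RHS]y0; apply: eq_bigl => k; rewrite enum_valP.
Qed.

Lemma entry_sumB (R : realType) (m : nat) (a b : 'cV[R]_m) :
  entry_sum (a - b) = entry_sum a - entry_sum b.
Proof. by rewrite /entry_sum -sumrB; apply: eq_bigr => i _; rewrite !mxE. Qed.

Lemma entry_sum_col_mx (R : realType) (m k : nat) (x : 'cV[R]_m) (y : 'cV[R]_k) :
  entry_sum (col_mx x y) = entry_sum x + entry_sum y.
Proof.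
rewrite /entry_sum big_split_ord /=; congr (_ + _); apply: eq_bigr => i _.
  by rewrite col_mxEu.
by rewrite col_mxEd.
Qed.

(** With [g] the gradient at [x], the gradient after the update is [g - M G g], and
    [Omega M G = Omega]. *)
Lemma cluster_step_gradient (R : realType) (n : nat) (C D : {set 'I_n})
    (X : 'M[R[i]]_n) (qD : 'cV[R]_#|~: C|) (x : 'cV[R]_#|C|) :
  X^T = X -> D \subset C -> D != finset.set0 ->
  (forall x, entry_sum x = 0 -> x != 0 -> 0 < qform (blockM C X) x) ->
  Omega R C D *m
    (blockM C X *m cluster_update X qD D x + blockN C X *m qD) = 0.
Proof.
move=> Xsym DC D0 Mpos; rewrite /cluster_update; set g := _ *m x + _.
rewrite mulmxBr addrAC -/g mulmxBr !mulmxA mul_compression_pinv ?subrr //.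
- exact: blockM_sym.
- exact: Omega_sym.
- exact: Omega_idem.
- exact: Omega_pos.
Qed.

(** Feasible displacements from the update lie in the range of [Omega], where the gradient at the
    update vanishes and [M] is positive. *)
Lemma cluster_stepP (R : realType) (n : nat) (C D : {set 'I_n})
    (X : 'M[R[i]]_n) (qD : 'cV[R]_#|~: C|) (x : 'cV[R]_#|C|) :
  X^T = X -> D \subset C -> D != finset.set0 ->
  (forall x, entry_sum x = 0 -> x != 0 -> 0 < qform (blockM C X) x) ->
  forall x', is_cluster_step X qD D x x' <-> x' = cluster_update X qD D x.
Proof.
move=> Xsym DC D0 Mpos.
have Ox0 : Omega R C D *m (cluster_update X qD D x - x) = cluster_update X qD D x - x.
  rewrite /cluster_update addrAC subrr add0r mulmxN mulmxA mul_pinv_compression //.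
  - exact: blockM_sym.
  - exact: Omega_sym.
  - exact: Omega_idem.
have Osub y : cluster_space D (y - x) ->
    Omega R C D *m (y - cluster_update X qD D x) = y - cluster_update X qD D x.
  by move=> /Omega_id Oy; rewrite -(addrKA (- x)) [- x + _]addrC mulmxBr Oy Ox0.
apply: stationary_minimizer => //.
- by rewrite /= -Ox0; exact: Omega_cluster_space.
- move=> y /Osub <-; rewrite trmx_mul Omega_sym -mulmxA cluster_step_gradient //.
  by rewrite mulmx0 mxE.
- by move=> y /Osub Oy yN; apply: (Omega_pos DC D0) => //; rewrite subr_eq0.
Qed.

(** The global problem is a single cluster step whose cluster is all of [C], taken from any feasible
    point. *)
Lemma global_optP (R : realType) (n : nat) (C : {set 'I_n}) (X : 'M[R[i]]_n)
    (qD : 'cV[R]_#|~: C|) : X^T = X -> C != finset.set0 ->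
  (forall x, entry_sum x = 0 -> x != 0 -> 0 < qform (blockM C X) x) ->
  exists qopt : 'cV[R]_#|C|, [/\ unique (is_global_opt X qD) qopt,
    entry_sum qopt + entry_sum qD = 0 &
    Omega R C C *m (blockM C X *m qopt + blockN C X *m qD) = 0].
Proof.
move=> Xsym C0 Mpos.
have m0 : #|C|%:R != 0 :> R by exact: cluster_card_neq0.
(* A feasible start: the demand off [C] is shared equally among the compensators. *)
pose x0 : 'cV[R]_#|C| := const_mx (- (entry_sum qD / #|C|%:R)).
have x0sum : entry_sum x0 + entry_sum qD = 0.
  rewrite /entry_sum; under eq_bigr do rewrite mxE.
  by rewrite sumr_const card_ord mulNrn -[X in - X]mulr_natr divfK // addNr.
have feasE : [set x | entry_sum (col_mx x qD) = 0] =
    [set x' | cluster_space C (x' - x0)].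
  apply/seteqP; split => x /=; rewrite cluster_space_full entry_sum_col_mx entry_sumB.
    by move=> /eqP; rewrite addr_eq0 => /eqP ->; rewrite -opprD addrC x0sum oppr0.
  by move=> /eqP; rewrite subr_eq0 => /eqP ->.
have optP x : is_global_opt X qD x <-> x = cluster_update X qD C x0.
  by rewrite /is_global_opt feasE; apply: cluster_stepP.
exists (cluster_update X qD C x0); split.
- by split=> [|x /optP ->//]; apply/optP.
- have /optP[] := erefl (cluster_update X qD C x0).
  by rewrite /= entry_sum_col_mx.
- exact: cluster_step_gradient.
Qed.

(** The columns of [Omega R C D] are zero-sum, hence fixed by [Omega R C C]; transposing gives the
    product in this order. It carries global optimality over to each cluster. *)
Lemma Omega_sub (R : realType) (n : nat) (C D : {set 'I_n}) :
  D \subset C -> D != finset.set0 -> C != finset.set0 ->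
  Omega R C D *m Omega R C C = Omega R C D.
Proof.
move=> DC D0 C0; apply/trmx_inj; rewrite trmx_mul !Omega_sym.
apply/trmx_inj/row_matrixP => i; apply/trmx_inj; rewrite -!tr_col !trmxK.
rewrite colE -mulmxA Omega_id ?colE // cluster_space_full.
by apply: (@cluster_space_sum0 _ _ _ D); exact: Omega_cluster_space.
Qed.

(** * Dynamics of the error *)

(** For [X] symmetric, [D] a nonempty subset of [C] and [M] positive on zero-sum vectors, this is
    the [M]-orthogonal projection onto the cluster space of [D]. *)
Definition error_step (R : realType) (n : nat) (C D : {set 'I_n})
    (X : 'M[R[i]]_n) : 'M[R]_#|C| :=
  pinvmp (Omega R C D *m blockM C X *m Omega R C D) *m blockM C X.

(** The gradient at [x] is [M (x - qopt)] plus the gradient at [qopt]; [G] kills the latter, since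
    [G = G Omega_D = G Omega_D Omega_C]. *)
Lemma cluster_update_error (R : realType) (n : nat) (C D : {set 'I_n})
    (X : 'M[R[i]]_n) (qD : 'cV[R]_#|~: C|) (qopt x : 'cV[R]_#|C|) :
  X^T = X -> D \subset C -> D != finset.set0 ->
  Omega R C C *m (blockM C X *m qopt + blockN C X *m qD) = 0 ->
  cluster_update X qD D x - qopt =
    (x - qopt) - error_step C D X *m (x - qopt).
Proof.
move=> Xsym DC D0 opt; rewrite /cluster_update /error_step; set G := pinvmp _.
have C0 : C != finset.set0.
  by apply: contraNneq D0 => C0; rewrite -finset.subset0 -C0.
rewrite addrAC; congr (_ - _); rewrite -mulmxA.
rewrite -[X in X + _](subrK (blockM C X *m qopt)) -addrA mulmxDr mulmxBr.
rewrite [X in _ + X](_ : _ = 0) ?addr0; first by rewrite !mulmxBr.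
rewrite -[G](@pinv_compression_mul _ _ (blockM C X) (Omega R C D)).
- by rewrite -(Omega_sub _ DC) // -!mulmxA opt !mulmx0.
- exact: blockM_sym.
- exact: Omega_sym.
- exact: Omega_idem.
Qed.

(** Along a chain of hyperedges the value passes through a node common to two consecutive ones. *)
Lemma hypergraph_const (n l : nat) (C : {set 'I_n}) (Cl : 'I_l -> {set 'I_n})
    (T : Type) (f : 'I_n -> T) : hypergraph_connected C Cl ->
  (forall k u v, u \in Cl k -> v \in Cl k -> f u = f v) ->
  forall u v, u \in C -> v \in C -> f u = f v.
Proof.
move=> hconn fconst u v uC vC; have [k [s [uk vs ps]]] := hconn _ _ uC vC.
elim: s k u {uC} uk vs ps => [|k' s IHs] k u uk vs /=; first by move=> _; exact: fconst vs.
case/andP=> /set0Pn[w]; rewrite inE => /andP[wk wk'] ps.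
by rewrite (fconst k u w) //; exact: IHs ps.
Qed.

(** * Comparison of quadratic forms by compactness *)

Lemma qform_continuous (R : realType) (m : nat) (A : 'M[R]_m) :
  continuous (fun u : 'rV[R]_m => qform A u^T).
Proof.
have -> : (fun u : 'rV[R]_m => qform A u^T) =
    fun u => \sum_i \sum_j u 0 i * A i j * u 0 j.
  apply/funext => u; rewrite qformE; apply: eq_bigr => i _; apply: eq_bigr => j _.
  by rewrite !mxE.
apply: continuous_big; first exact: add_continuous.
move=> i _; apply: continuous_big; first exact: add_continuous.
move=> j _ u; have cvgu k : (v 0 k : R) @[v --> u] --> (u 0 k : R).
  exact: coord_continuous.
exact: (cvgM (cvgM (cvgu i) (cvg_cst (A i j))) (cvgu j)).
Qed.

(** On the compact set of zero-sum unit vectors [A] has a positive minimum and [B] a finite maximum;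
    homogeneity extends the comparison to all zero-sum vectors. *)
Lemma qform_dominates (R : realType) (m : nat) (A B : 'M[R]_m) :
  (forall x, entry_sum x = 0 -> x != 0 -> 0 < qform A x) ->
  exists2 c, 0 < c & forall x, entry_sum x = 0 -> c * qform B x <= qform A x.
Proof.
move=> Apos.
(* The unit sphere is that of the max norm, which suffices because both forms scale by the square of
   the factor. *)
pose S := [set u : 'rV[R]_m | entry_sum u^T = 0] `&` [set u : 'rV[R]_m | `|u| = 1].
have Sscale (x : 'cV[R]_m) : entry_sum x = 0 -> x != 0 -> S (`|x^T|^-1 *: x^T).
  move=> x0 xN0; have xTN0 : x^T != 0 by rewrite trmx_eq0.
  split=> /=.
    rewrite linearZ /= trmxK /entry_sum; under eq_bigr do rewrite mxE.
    by rewrite -mulr_sumr [X in _ * X]x0 mulr0.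
  by rewrite normrZ normfV normr_id mulVf // normr_eq0.
have qformZ (M : 'M[R]_m) k (x : 'cV[R]_m) : qform M (k *: x) = k ^+ 2 * qform M x.
  rewrite /qform [(k *: x)^T]linearZ /= -!scalemxAl -scalemxAr.
  by rewrite mxE [X in _ * X]mxE mulrA expr2.
(* If [S] is empty, zero is the only zero-sum vector and any constant works. *)
have [S0|/set0P S0] := eqVneq S set0.
  exists 1 => // x x0; have [->|xN0] := eqVneq x 0; first by rewrite !qform0 mulr0.
  by have := Sscale _ x0 xN0; rewrite S0.
have cS : compact S.
  apply: bounded_closed_compact.
    by exists 1; split=> // M M1 u [_ /= ->]; exact: ltW.
  apply: closedI.
    apply: (@preimage_closed _ _ (fun u : 'rV[R]_m => entry_sum u^T) [set x | x = 0]).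
      move=> u _; rewrite /entry_sum; under eq_fun do under eq_bigr do rewrite mxE.
      apply: continuous_big; first exact: add_continuous.
      by move=> i _; exact: coord_continuous.
    exact: closed_eq.
  apply: (@preimage_closed _ _ (fun u : 'rV[R]_m => `|u|) [set x | x = 1]).
    by move=> u _; exact: norm_continuous.
  exact: closed_eq.
have cont (M : 'M[R]_m) : {within S, continuous (fun u : 'rV[R]_m => qform M u^T)}.
  by apply: continuous_subspaceT; exact: qform_continuous.
have [u uS minA] := EVT_min_rV S0 cS (cont A).
have [v vS maxB] := EVT_max_rV S0 cS (cont B).
have [u0 u1] := set_mem uS.
have a0 : 0 < qform A u^T.
  apply: Apos => //; rewrite trmx_eq0; apply: contra_eq_neq u1 => ->.
  by rewrite normr0 eq_sym oner_eq0.
set a := qform A u^T in a0 minA; set b := qform B v^T in maxB.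
(* The denominator bounds [b] from above and stays positive even when [b] is not. *)
exists (a / (1 + `|b|)) => [|x x0].
  by rewrite divr_gt0 // ltr_pwDl.
have [->|xN0] := eqVneq x 0; first by rewrite !qform0 mulr0.
have xS := mem_set (Sscale _ x0 xN0).
have := minA _ xS; have := maxB _ xS.
rewrite !linearZ /= !trmxK !qformZ; set k := _ ^+ 2 => kB kA.
have k0 : 0 < k by rewrite exprn_gt0 // invr_gt0 normr_gt0 trmx_eq0.
have b1 : 0 < 1 + `|b| by rewrite ltr_pwDl.
rewrite -(ler_pM2l k0) (le_trans _ kA) // mulrCA.
rewrite mulrAC ler_pdivrMr // ler_pM2l //.
by rewrite (le_trans kB) // (le_trans (ler_norm b)) // lerDr.
Qed.

Lemma qform_sandwich (R : realType) (m k : nat) (A : 'M[R]_m) (B : 'M[R]_(m, k)) x :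
  qform (B^T *m A *m B) x = qform A (B *m x).
Proof. by rewrite /qform trmx_mul !mulmxA. Qed.

Lemma qform_sum (R : realType) (m l : nat) (rho : 'I_l -> R)
    (A : 'I_l -> 'M[R]_m) x :
  qform (\sum_k rho k *: A k) x = \sum_k rho k * qform (A k) x.
Proof.
rewrite /qform mulmx_sumr mulmx_suml summxE; apply: eq_bigr => k _.
by rewrite -scalemxAr -scalemxAl mxE.
Qed.

Lemma sqnormE (R : realType) (m : nat) (x : 'cV[R]_m) : sqnorm x = qform 1%:M x.
Proof.
by rewrite /qform mulmx1 mxE; apply: eq_bigr => i _; rewrite mxE expr2.
Qed.

(** * Contraction of the expected energy in one step *)

Section ExpectedContraction.
Context (R : realType) (n l : nat) (C : {set 'I_n}) (X : 'M[R[i]]_n).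
Context (Cl : 'I_l -> {set 'I_n}) (rho : 'I_l -> R).
Hypotheses (Xsym : X^T = X) (C0 : C != finset.set0).
Hypothesis (Mpos :
  forall x, entry_sum x = 0 -> x != 0 -> 0 < qform (blockM C X) x).
Hypotheses (ClC : forall k, Cl k \subset C) (Cl0 : forall k, Cl k != finset.set0).
Hypothesis hconn : hypergraph_connected C Cl.
Hypothesis rho_gt0 : forall k, 0 < rho k.

Let M := blockM C X.

Lemma qformM_ge0 x : entry_sum x = 0 -> 0 <= qform M x.
Proof.
by move=> x0; have [->|xN0] := eqVneq x 0; rewrite ?qform0 // ltW // Mpos.
Qed.

Lemma error_step_cluster k x : cluster_space (Cl k) (error_step C (Cl k) X *m x).
Proof.
rewrite /error_step -[pinvmp _](@mul_pinv_compression _ _ M (Omega R C (Cl k))).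
- by move: (pinvmp _) => G; rewrite -!mulmxA; exact: Omega_cluster_space.
- exact: blockM_sym.
- exact: Omega_sym.
- exact: Omega_idem.
Qed.

Lemma error_step_energy k x :
  qform M (x - error_step C (Cl k) X *m x) =
  qform M x - qform M (error_step C (Cl k) X *m x).
Proof.
have := @compression_step_energy _ _ M (Omega R C (Cl k)) (blockM_sym C Xsym)
  (Omega_sym _ _ _) (Omega_idem _ (ClC k) (Cl0 k))
  (Omega_pos (ClC k) (Cl0 k) Mpos) x.
by rewrite /error_step -(mulmxA (pinvmp _)).
Qed.

(* A zero-sum vector fixed by all the steps has a gradient M x which is constant
   on each cluster, hence on C, so that x^T M x = 0. *)
Lemma error_step_eq0 x : entry_sum x = 0 ->
  (forall k, error_step C (Cl k) X *m x = 0) -> x = 0.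
Proof.
move=> x0 step0; apply/eqP/negPn/negP => /(Mpos x0).
have clusterM k i j : enum_val i \in Cl k -> enum_val j \in Cl k ->
    (M *m x) i 0 = (M *m x) j 0.
  (* Writing [Omega] as [Omega M G] exposes the factor [G M x], which is zero. *)
  have OMx : Omega R C (Cl k) *m (M *m x) = 0.
    rewrite -(@mul_compression_pinv _ _ M (Omega R C (Cl k))) ?blockM_sym ?Omega_sym //.
    - by rewrite -(mulmxA _ (pinvmp _)) (mulmxA (pinvmp _)) step0 mulmx0.
    - exact: Omega_idem.
    - exact: Omega_pos.
  (* A vector killed by [Omega] equals its cluster mean at each node of the cluster. *)
  have MxE s : enum_val s \in Cl k -> (M *m x) s 0 =
      #|Cl k|%:R^-1 * \sum_(k' | enum_val k' \in Cl k) (M *m x) k' 0.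
    move=> sk; apply/eqP; rewrite -subr_eq0.
    by have := Omega_mulE (Cl k) (M *m x) s; rewrite OMx sk mul1r mxE => <-.
  by move=> ik jk; rewrite !MxE.
have /set0Pn[v0 v0C] := C0.
(* Nodes outside [C] receive a default coordinate; [f] is only compared at nodes of [C]. *)
pose f v := (M *m x) (enum_rank_in v0C v) 0.
have fE v w : v \in C -> w \in C -> f v = f w.
  apply: (hypergraph_const hconn) => k u u' uk u'k.
  have sub := fintype.subsetP (ClC k).
  by apply: (clusterM k); rewrite enum_rankK_in ?sub.
rewrite -/M /qform -mulmxA mxE (eq_bigr (fun i => x i 0 * f v0)) => [|i _].
  by rewrite -mulr_suml [X in X * _]x0 mul0r ltxx.
by rewrite mxE -(fE (enum_val i)) ?enum_valP // /f enum_valK_in.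
Qed.

(** [F] is the averaged energy drop. It is positive definite on zero-sum vectors by
    [error_step_eq0], so it dominates a fixed fraction of [M], and this fraction is lost on
    average. *)
Lemma expected_contraction : \sum_k rho k = 1 ->
  exists c, [/\ 0 <= c, c < 1 & forall x, entry_sum x = 0 ->
    \sum_k rho k * qform M (x - error_step C (Cl k) X *m x) <= c * qform M x].
Proof.
move=> rho1; pose E k := error_step C (Cl k) X.
have sum0 k x : entry_sum (E k *m x) = 0.
  by apply: (@cluster_space_sum0 _ _ _ (Cl k)); exact: error_step_cluster.
pose F := \sum_k rho k *: ((E k)^T *m M *m E k).
have FE x : qform F x = \sum_k rho k * qform M (E k *m x).
  by rewrite qform_sum; under eq_bigr do rewrite qform_sandwich.
have term_ge0 x k : 0 <= rho k * qform M (E k *m x).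
  by rewrite mulr_ge0 ?qformM_ge0 // ltW.
have [x x0 xN0|c c0 cF] := @qform_dominates _ _ F M.
  rewrite FE lt_def sumr_ge0 // andbT; apply: contraNneq xN0 => /eqP.
  rewrite psumr_eq0 // => /allP F0; apply/eqP/error_step_eq0 => // k.
  apply/eqP/negPn/negP => ExN0; have := F0 k (mem_index_enum k).
  by rewrite /= mulf_eq0 !gt_eqF // Mpos.
(* Capping [c] at 1 keeps the factor nonnegative, so that the bound can be iterated. *)
exists (1 - Num.min c 1); split.
- by rewrite subr_ge0 ge_min lexx orbT.
- by rewrite ltrBlDr ltrDl lt_min c0 ltr01.
move=> x x0; under eq_bigr do rewrite error_step_energy mulrBr.
rewrite sumrB -mulr_suml rho1 mul1r -FE mulrBl mul1r lerD2l lerN2.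
rewrite (le_trans _ (cF x x0)) // ler_wpM2r ?qformM_ge0 //.
by rewrite ge_min lexx.
Qed.

End ExpectedContraction.

(** * Words of cluster choices and the law of the history *)

(** Words grow on the right, so the last letter is the latest draw and sums over words split off the
    last step. *)
Fixpoint words (K : finType) (t : nat) : seq (seq K) :=
  if t is t'.+1 then [seq rcons w k | w <- words K t', k <- enum K] else [:: [::]].

Lemma size_words (K : finType) t w : w \in words K t -> size w = t.
Proof.
elim: t w => [|t IHt] w /=; first by rewrite inE => /eqP ->.
by move=> /allpairsP[[v k] [/= /IHt <- _ ->]]; rewrite size_rcons.
Qed.

Lemma sum_wordsS (R : realType) (K : finType) t (F : seq K -> R) :
  \sum_(w <- words K t.+1) F w = \sum_(w <- words K t) \sum_k F (rcons w k).
Proof. 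
rewrite /= big_flatten big_map; apply: eq_bigr => w _.
by rewrite big_map big_enum. Qed.

Definition history (T : Type) (K : Type) (r : nat -> T -> K) (t : nat) (w : T) : seq K :=
  [seq r s w | s <- iota 0 t].

Lemma historyS (T K : Type) (r : nat -> T -> K) t w :
  history r t.+1 w = rcons (history r t w) (r t w).
Proof. by rewrite /history -addn1 iotaD map_cat cats1. Qed.

Lemma size_history (T K : Type) (r : nat -> T -> K) t w :
  size (history r t w) = t.
Proof. by rewrite size_map size_iota. Qed.

(** Only the word equal to the history contributes. This writes a function of the history as a
    finite combination of indicators, ready for integration. *)
Lemma sum_history (R : realType) (T : Type) (K : finType) (r : nat -> T -> K)
    t w (phi : seq K -> R) :
  \sum_(s <- words K t) phi s * (history r t w == s)%:R = phi (history r t w).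
Proof.
elim: t phi => [|t IHt] phi; first by rewrite big_seq1 eqxx mulr1.
rewrite sum_wordsS historyS -(IHt (fun s => phi (rcons s (r t w)))).
apply: eq_bigr => s _; rewrite (bigD1 (r t w)) //= eqseq_rcons eqxx andbT.
rewrite big1 ?addr0 // => k kN; rewrite eqseq_rcons [r t w == k]eq_sym (negPf kN).
by rewrite andbF mulr0.
Qed.

Section IidExpectation.
Context (d : measure_display) (T : measurableType d) (R : realType).
Context (P : probability T R) (l : nat) (r : nat -> T -> 'I_l) (rho : 'I_l -> R).
Hypothesis hr : iid_with_law P r rho.

Lemma history_eqE (s : seq 'I_l) (k0 : 'I_l) :
  [set w | history r (size s) w = s] =
  \bigcap_(t in [set` iota 0 (size s)]) (r t @^-1` [set nth k0 s t]).
Proof.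
apply/seteqP; split=> [w <- t /=|w /= rs].
  rewrite size_history mem_iota add0n => tn.
  by rewrite (nth_map 0%N) ?size_iota // nth_iota.
apply: (@eq_from_nth _ k0); rewrite size_history // => t ts.
rewrite (nth_map 0%N) ?size_iota // nth_iota // add0n.
by have /= -> := rs t; rewrite //= mem_iota.
Qed.

Lemma history_measurable (s : seq 'I_l) :
  measurable [set w | history r (size s) w = s].
Proof.
case: s => [|k0 s]; first by rewrite (_ : [set _ | _] = setT) //; apply/seteqP; split.
have [rmeas _ _] := hr.
rewrite (history_eqE _ k0); apply: fin_bigcap_measurable => // t _; exact: rmeas.
Qed.

Lemma history_prob (s : seq 'I_l) :
  P [set w | history r (size s) w = s] = (\prod_(k <- s) rho k)%:E.
Proof.
(* The empty word is treated apart, as it has no letter to serve as the default of [nth]. *)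
case: s => [|k0 s].
  rewrite big_nil (_ : [set _ | _] = setT) ?probability_setT //.
  by apply/seteqP; split.
have [_ rlaw rindep] := hr.
rewrite (history_eqE _ k0) (rindep _ (fun t => [set nth k0 (k0 :: s) t])) ?iota_uniq //.
rewrite (big_nth k0) -prodEFin /index_iota subn0.
by apply: eq_bigr => t _; exact: rlaw.
Qed.

(** Integrating the indicator expansion term by term, as nonnegativity of [phi] permits, leaves the
    probability of each word, a product by independence. *)
Lemma expectation_history t (phi : seq 'I_l -> R) : (forall s, 0 <= phi s) ->
  ('E_P[fun w => phi (history r t w)] =
   (\sum_(s <- words 'I_l t) (\prod_(k <- s) rho k) * phi s)%:E)%E.
Proof.
move=> phi0; rewrite unlock.
have eqI s : s \in words 'I_l t -> forall w,
    (history r t w == s)%:R = \1_[set w | history r (size s) w = s] w :> R.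
  move=> /size_words sE w; rewrite indicE sE; congr (nat_of_bool _)%:R.
  by apply/eqP/idP => [|/set_mem//]; exact: mem_set.
have -> : (fun w => (phi (history r t w))%:E) = (fun w => \sum_(s <- words 'I_l t)
    (phi s)%:E * (\1_[set w | history r (size s) w = s] w)%:E)%E.
  apply/funext => w; rewrite -sum_history -sumEFin; apply: eq_big_seq => s st.
  by rewrite eqI.
rewrite ge0_integral_sum //.
- rewrite -sumEFin; apply: eq_bigr => s _.
  have mA := history_measurable s; rewrite ge0_integralZl //; last by rewrite lee_fin.
    by rewrite integral_indic // setIT [X in (_ * X)%E](history_prob s) EFinM muleC.
  exact/measurable_EFinP/measurable_indic.
- move=> s; apply: measurable_funeM.
  exact/measurable_EFinP/measurable_indic/history_measurable.
- by move=> s w _; rewrite mule_ge0 ?lee_fin.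
Qed.

(** The constant 1 has expectation 1, and over words of length one this expectation is the sum of
    the weights. *)
Lemma law_sum1 : \sum_k rho k = 1.
Proof.
have := @expectation_history 1 (cst 1) (fun=> ler01).
rewrite expectation_cst => -[->].
rewrite [RHS](sum_wordsS 0) big_seq1.
by apply: eq_bigr => k _; rewrite big_seq1 mulr1.
Qed.

End IidExpectation.

(** * Mean-square convergence *)

Theorem corollary8 (R : realType)
  (n p : nat) (src tgt : 'I_p -> 'I_n) (v0 : 'I_n)
  (hG : graph_connected src tgt)
  (z : 'I_p -> R[i]) (hz : forall e, 0 < complex.Re (z e))
  (X : 'M[R[i]]_n) (hX : is_green_mx v0 (laplacian_mx src tgt z) X)
  (C : {set 'I_n}) (hC : (2 <= #|C|)%N)
  (qD : 'cV[R]_#|~: C|)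
  (l : nat) (Cl : 'I_l -> {set 'I_n})
  (hCl : forall k, Cl k != finset.set0)
  (hcover : (\bigcup_k Cl k)%SET = C)
  (hconn : hypergraph_connected C Cl)
  (d : measure_display) (T : measurableType d) (P : probability T R)
  (r : nat -> T -> 'I_l) (rho : 'I_l -> R) (hrho : forall k, 0 < rho k)
  (hr : iid_with_law P r rho) :
  (forall (k : 'I_l) (x : 'cV[R]_#|C|), entry_sum x + entry_sum qD = 0 ->
     forall x', is_cluster_step X qD (Cl k) x x' <->
                x' = cluster_update X qD (Cl k) x)
  /\
  exists qopt : 'cV[R]_#|C|,
    unique (is_global_opt X qD) qopt /\
    forall (q0 : 'cV[R]_#|C|) (q : nat -> T -> 'cV[R]_#|C|),
      entry_sum q0 + entry_sum qD = 0 ->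
      (forall w, q 0%N w = q0) ->
      (forall t w, is_cluster_step X qD (Cl (r t w)) (q t w) (q t.+1 w)) ->
      ('E_P[fun w => sqnorm (q t w - qopt)])%E @[t --> \oo] --> 0%E.
Proof.
have [Xsym _ _] := hX.
have C0 : C != finset.set0 by rewrite -card_gt0 (leq_trans _ hC).
have ClC k : Cl k \subset C by rewrite -hcover; exact: finset.bigcup_sup.
have Mpos x : entry_sum x = 0 -> x != 0 -> 0 < qform (blockM C X) x.
  exact: (blockM_gt0 hz hX).
have stepP k x := cluster_stepP qD x Xsym (ClC k) (hCl k) Mpos.
split=> [k x _|]; first exact: stepP.
have [qopt [opt_uniq opt_sum opt_grad]] := global_optP qD Xsym C0 Mpos.
exists qopt; split=> // q0 q q0_sum q_init q_step.
(* The trajectory is a deterministic function of the first [t] draws, so expectations become finite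
   sums over words. *)
have qE t w : q t w =
    foldl (fun x k => cluster_update X qD (Cl k) x) q0 (history r t w).
  elim: t => [|t IHt]; first exact: q_init.
  by rewrite historyS foldl_rcons -IHt; apply/stepP.
pose e s := foldl (fun x k => cluster_update X qD (Cl k) x) q0 s - qopt.
pose V x := qform (blockM C X) x.
have eS s k : e (rcons s k) = e s - error_step C (Cl k) X *m e s.
  by rewrite /e foldl_rcons cluster_update_error.
have e_sum s : entry_sum (e s) = 0.
  elim/last_ind: s => [|s k IHs].
    apply/eqP; rewrite entry_sumB subr_eq0.
    by rewrite -(inj_eq (addIr (entry_sum qD))) q0_sum opt_sum.
  rewrite eS entry_sumB IHs sub0r (@cluster_space_sum0 _ _ _ (Cl k)) ?oppr0 //.
  exact: error_step_cluster.
have [c [c0 c1 contr]] :=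
  expected_contraction Xsym C0 Mpos ClC hCl hconn hrho (law_sum1 hr).
have weight_ge0 (s : seq 'I_l) : 0 <= \prod_(k <- s) rho k.
  by apply: prodr_ge0 => k _; exact: ltW.
pose EV t := \sum_(s <- words 'I_l t) (\prod_(k <- s) rho k) * V (e s).
(* Summing over the last letter first amounts to conditioning on the earlier draws; the contraction
   then applies to each error [e s]. *)
have EV_le t : EV t <= c ^+ t * V (e [::]).
  elim: t => [|t IHt]; first by rewrite /EV big_seq1 big_nil.
  rewrite exprS -mulrA (le_trans _ (ler_wpM2l c0 IHt)) // /EV sum_wordsS mulr_sumr.
  apply: ler_sum => s _; rewrite mulrCA.
  rewrite (eq_bigr (fun k => (\prod_(k' <- s) rho k') *
    (rho k * V (e s - error_step C (Cl k) X *m e s)))) => [|k _].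
    by rewrite -mulr_sumr ler_wpM2l ?contr ?e_sum ?weight_ge0.
  by rewrite eS big_rcons /= mulrA.
(* Compares the squared norm with the energy: [sqnorm x] is at most [a^-1 * V x] on zero-sum
   vectors. *)
have [a a0 aV] := qform_dominates 1%:M Mpos.
have sqnorm_ge0 (x : 'cV[R]_#|C|) : 0 <= sqnorm x.
  by apply: sumr_ge0 => i _; exact: sqr_ge0.
have mse t : ('E_P[fun w => sqnorm (q t w - qopt)] =
    (\sum_(s <- words 'I_l t) (\prod_(k <- s) rho k) * sqnorm (e s))%:E)%E.
  rewrite -(expectation_history hr) //; congr expectation.
  by apply/funext => w; rewrite qE.
under eq_cvg do rewrite mse.
apply: cvg_EFin; first by near=> t.
apply: (@squeeze_cvgr _ _ _ _ (cst 0) (fun t => a^-1 * V (e [::]) * c ^+ t)).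
- near=> t; apply/andP; split.
    by apply: sumr_ge0 => s _; rewrite mulr_ge0.
  rewrite /= mulrAC -mulrA (le_trans _ (ler_wpM2l (ltW _) (EV_le t))) ?invr_gt0 //.
  rewrite mulr_sumr; apply: ler_sum => s _; rewrite mulrCA ler_wpM2l //.
  by rewrite sqnormE ler_pdivlMl // aV.
- exact: cvg_cst.
- rewrite -[X in _ --> X](mulr0 (a^-1 * V (e [::]))); apply: cvgMr.
  by apply: cvg_expr; rewrite ger0_norm.
Unshelve. all: by end_near.
Qed.
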